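(* Let $\{X_\alpha:\alpha\in A\}$ be a family of bi-sequential spaces, and let $X=\prod_{\alpha\in A}X_\alpha$. (1) If $\mathrm{Card}(A)$ is non-Ulam-measurable, the product $X$ has countable functional tightness. (2) If $\mathrm{Card}(A)$ is non-sequential, the product $X$ is $f$-sequential.
   Context: A space $X$ is bi-sequential if every ultrafilter on $X$ converging to a point $x\in X$ contains a filter with a countable basis converging to the same point $x$. A function $f:X\to Y$ is $\omega$-continuous if for every countable subset $B\subset X$ the restriction $f|B:B\to Y$ is continuous. A space $X$ has countable functional tightness if every $\omega$-continuous function $f:X\to\mathbb R$ is continuous. A space $X$ is $f$-sequential if every sequentially continuous function $f:X\to\mathbb R$ is continuous. A cardinal $\tau$ is sequential if the space $2^\tau$ (product of $\tau$ copies of the two-point discrete space) is not $f$-sequential; otherwise it is non-sequential. An ultrafilter is $\omega_1$-complete if it is closed under intersections of countable families. A cardinal $\mathrm{Card}(A)$ is Ulam-measurable if there exists an $\omega_1$-complete free (nonprincipal) ultrafilter on $A$. *)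

(* Defs.v *)
From mathcomp Require Import all_boot all_order all_algebra.
From mathcomp Require Import all_classical all_reals all_analysis.

Set Implicit Arguments.
Unset Strict Implicit.
Unset Printing Implicit Defensive.

Import numFieldNormedType.Exports.
Local Open Scope classical_set_scope.

Definition has_countable_basis (T : Type) (G : set_system T) : Prop :=
  exists B : set (set T),
    [/\ countable B, B `<=` G &
        forall S : set T, G S -> exists2 D, B D & D `<=` S].

(* [U --> x] reads [nbhs x `<=` U], i.e. the filter [U] converges to [x]; no
   separation axiom is assumed, so limits need not be unique. *)
Definition bi_sequential (X : topologicalType) : Prop :=
  forall (U : set_system X) (x : X), UltraFilter U -> U --> x ->
  exists G : set_system X,
    [/\ Filter G, G `<=` U, has_countable_basis G & G --> x].

Definition omega_continuous (X Y : topologicalType) (f : X -> Y) : Prop :=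
  forall B : set X, countable B -> {within B, continuous f}.

Definition countable_functional_tightness (R : realType)
    (X : topologicalType) : Prop :=
  forall f : X -> R, omega_continuous f -> continuous f.

Definition sequentially_continuous (X Y : topologicalType) (f : X -> Y) :
    Prop :=
  forall (u : nat -> X) (x : X),
    u n @[n --> \oo] --> x -> f (u n) @[n --> \oo] --> f x.

Definition f_sequential (R : realType) (X : topologicalType) : Prop :=
  forall f : X -> R, sequentially_continuous f -> continuous f.

(* A cardinal is represented by a type of that cardinality; [bool] carries the
   discrete topology. *)
Definition sequential_card (R : realType) (A : Type) : Prop :=
  ~ f_sequential R (prod_topology (fun _ : A => bool)).

Definition omega1_complete (A : Type) (U : set_system A) : Prop :=
  forall C : set (set A), countable C -> C `<=` U ->
    U (\bigcap_(S in C) S).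

Definition free_filter (A : Type) (U : set_system A) : Prop :=
  \bigcap_(S in U) S = set0.

Definition Ulam_measurable_card (A : Type) : Prop :=
  exists U : set_system A, [/\ UltraFilter U, omega1_complete U & free_filter U].

(* Main.v *)
Require Import Defs.
From mathcomp Require Import all_boot all_order all_algebra.
From mathcomp Require Import all_classical all_reals all_analysis.
From mathcomp Require Import lra.

Set Implicit Arguments.
Unset Strict Implicit.
Unset Printing Implicit Defensive.

Import Order.TTheory GRing.Theory Num.Theory.
Import numFieldNormedType.Exports.
Local Open Scope classical_set_scope.
Local Open Scope ring_scope.

(** Both parts reduce to functions on the Cantor cube [2^A]. Let [f] be a
    sequentially continuous function on the product and let [x], [y] be two
    points of it. A subset [S] of [A], seen as a point of [2^A], gives the point
    [mix S y x] that agrees with [y] on [S] and with [x] off [S]; this is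
    continuous in [S], so [g S := f (mix S y x)] inherits the continuity
    properties of [f] and satisfies [g A = f y].

    Call [f] countably recoverable if for all [x], [y] the value [f y] is
    approximated by the values [f (mix S y x)] with [S] countable. Then [f] is
    continuous ([recoverable_continuous]). Otherwise some ultrafilter [U]
    converging to [x] lives on points [y] with [f y] far from [f x]. Truncating
    each such [y] to a suitable countable set [S y] keeps [f] away from [f x].
    The truncated points still converge to [x] along [U], so bi-sequentiality of
    the factor at [a] provides countably many members of the image ultrafilter
    that shrink to the coordinate [x a]. Only the coordinates in the supports of
    the points chosen so far matter, and they are countable in number, so a
    diagonal choice ([support_diagonal]) gives a sequence of truncated points
    converging to [x], against sequential continuity.

    It remains to see that [f] is countably recoverable. If [Card A] is
    non-sequential, then [g] is continuous and [g A] is the limit of [g K] over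
    the finite sets [K] ([finite_sets_approximate]).

    If [Card A] is not Ulam-measurable and [g] is omega-continuous, then
    [g S = g A] for some countable [S] ([countable_set_attains]). The argument
    measures a set [T] by the oscillation of [g] under changes inside [T]. An
    infinite disjoint sequence contains sets of arbitrarily small oscillation
    ([disjoint_osc_le]): otherwise witnesses [P n], [Q n] of a large
    oscillation that agree off [T n] would have a common limit along a
    nonprincipal ultrafilter. Hence, for each [e > 0], [A] is covered by
    countably many sets, each countable or of oscillation at most [e]
    ([small_cover_setT]): otherwise, shrinking a set without such a cover as
    long as possible, one reaches a set whose uncovered subsets form an
    omega_1-complete free ultrafilter. Let [C] be the union of the countable
    pieces for [e = 1/(n+1)]. Removing from [A] the parts off [C] of finitely
    many pieces of small total oscillation hardly changes [g]. There are only
    countably many sets of this form and [C] is in their closure, so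
    omega-continuity forces [g C = g A]. *)

(** * Convergence and substitution in products *)

Lemma cvg_prod_topology (I : Type) (K : I -> topologicalType)
    (F : set_system (prod_topology K)) (x : prod_topology K) :
  Filter F ->
  (F --> x) <-> (forall i, y i @[y --> F] --> x i).
Proof.
move=> FF; split=> [Fx i N|Fx].
  rewrite nbhsE => -[W [oW Wx] WN].
  apply: (Fx [set y | N (y i)]).
  have /cvg_sup/(_ i) : nbhs x --> x by [].
  apply.
  rewrite nbhsE /=.
  exists [set y | W (y i)]; last by move=> y /= /WN.
  by split => //; exists W.
apply/cvg_sup => i N; rewrite nbhsE /= => -[W [[B oB <-] Wx] WN].
apply: filterS WN _.
by apply: (Fx i); apply: open_nbhs_nbhs.
Qed.

(** As a function of [S], the subcube of the product with opposite corners [x]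
    and [y]. *)
Definition mix (A : Type) (X : A -> Type) (S : A -> bool) (y x : forall a, X a)
  : forall a, X a := fun a => if S a then y a else x a.

Lemma mix_continuous (A : Type) (X : A -> topologicalType)
    (y x : prod_topology X) :
  continuous (fun S : prod_topology (fun _ : A => bool) =>
                mix S y x : prod_topology X).
Proof.
move=> S; apply/cvg_prod_topology => a N xN.
have /cvg_prod_topology/(_ a) Sa : nbhs S --> S by [].
have /Sa /= : nbhs (S a : bool) [set S a].
  exact/principal_filterP.
apply: (@filterS _ (nbhs S) (nbhs_filter S)) => T /= TS; rewrite /mix.
by rewrite TS; exact: nbhs_singleton xN.
Qed.

(** * Countable sets and weak forms of continuity *)

Lemma countable_enum (T : Type) (D : set T) :
  countable D -> D !=set0 -> exists e : nat -> T, range e = D.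
Proof.
move=> /pfcard_geP[-> [? []]//|[e] _].
by exists e; apply: surj_image_eq => [_ [n _ <-]|]; [apply: funS|apply: surj].
Qed.

Lemma countable_setU (T : Type) (D E : set T) :
  countable D -> countable E -> countable (D `|` E).
Proof.
move=> cD cE; rewrite -bigcup2E; apply: bigcup_countable => // -[|[|n]] _ //=.
Qed.

Lemma countable_range_countType (I : countType) (T : Type) (u : I -> T) :
  countable (range u).
Proof. exact: sub_countable (card_image_le _ _) (countableP _). Qed.

(** The restriction of [f] to the range of [u] together with [x] is continuous.
    The filter [F] may be arbitrary as long as [u] takes countably many values:
    below it is an ultrafilter on [nat] or the filter of finite sets. *)
Lemma cvg_omega_continuous (X Y : topologicalType) (f : X -> Y) (I : Type)
    (F : set_system I) (u : I -> X) (x : X) :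
  omega_continuous f -> Filter F -> countable (range u) ->
  u i @[i --> F] --> x -> f (u i) @[i --> F] --> f x.
Proof.
move=> fc FF cu ux.
have /subspace_continuousP/(_ x) : {within range u `|` [set x], continuous f}.
  by apply: fc; apply: countable_setU => //; exact: countable1.
move=> /(_ (or_intror erefl)) fx N /fx /=; rewrite nbhs_simpl /= => /ux.
apply: (@filterS _ F) => i; apply; left; by exists i.
Qed.

Lemma omega_continuous_sequentially (X Y : topologicalType) (f : X -> Y) :
  omega_continuous f -> sequentially_continuous f.
Proof.
move=> fc u x ux; apply: cvg_omega_continuous => //.
exact: countable_range_countType.
Qed.

Lemma omega_continuous_comp (X Y Z : topologicalType) (h : X -> Y)
    (f : Y -> Z) :
  continuous h -> omega_continuous f -> omega_continuous (f \o h).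
Proof.
move=> hc fc B cB; apply/subspace_continuousP => x Bx.
have /subspace_continuousP/(_ (h x)) : {within h @` B, continuous f}.
  by apply: fc; apply: sub_countable (card_image_le _ _) cB.
move=> /(_ (imageP _ Bx)) fx N /fx /=; rewrite !nbhs_simpl /= => /hc /=.
by apply: (@filterS _ (nbhs x)) => z hz Bz; apply: hz; exists z.
Qed.

Lemma sequentially_continuous_comp (X Y Z : topologicalType) (h : X -> Y)
    (f : Y -> Z) :
  continuous h -> sequentially_continuous f -> sequentially_continuous (f \o h).
Proof. by move=> hc fc u x ux; apply: fc; apply: cvg_comp ux (hc x). Qed.

(** * From recoverability to continuity *)

Lemma bi_sequential_basis (X : topologicalType) (U : set_system X) (x : X) :
  bi_sequential X -> UltraFilter U -> U --> x ->
  exists2 B : nat -> set X, forall n, U (B n) &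
    forall N, nbhs x N -> exists n, B n `<=` N.
Proof.
move=> bX UU Ux; have [G [FG GU [BB [cB BG Bsub]] Gx]] := bX U x UU Ux.
have [D BD _] := Bsub _ (@filterT _ G _).
have [|e eE] := countable_enum cB; first by exists D.
exists e => [n|N /Gx /Bsub[E]]; first by apply/GU/BG; rewrite -eE; exists n.
by rewrite -eE => -[n _ <-]; exists n.
Qed.

Lemma ultra_of_setVsetC (T : Type) (F : set_system T) :
  ProperFilter F -> (forall D, F D \/ F (~` D)) -> UltraFilter F.
Proof.
move=> PF FVC; split=> // G PG FG; apply/seteqP; split=> // D GD.
have [//|/FG GnD] := FVC D.
by have [? []] := @filter_ex _ G PG _ (filterI GD GnD).
Qed.

Lemma ultra_fmap (T T' : Type) (h : T -> T') (U : set_system T) :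
  UltraFilter U -> UltraFilter (h @ U).
Proof.
move=> UU; apply: ultra_of_setVsetC => D.
exact: (in_ultra_setVsetC (h @^-1` D) UU).
Qed.

(** When [z 0], ..., [z n.-1] are chosen, only finitely many members of [U]
    constrain [z n]. *)
Lemma diagonal_sequence (T : Type) (U : set_system T) (E : set T)
    (V : T -> nat -> set T) :
  ProperFilter U -> U E -> (forall y n, U (V y n)) ->
  exists2 z : nat -> T, forall n, E (z n) &
    forall i n, (i < n)%N -> V (z i) n (z n).
Proof.
move=> PU UE UV.
(* [s] lists the points chosen so far. *)
have UVs s n : \forall z \near U, forall i y0, (i < size s)%N ->
    V (nth y0 s i) n z.
  elim: s => [|y s IHs]; first exact: nearW.
  apply: filterS2 (UV y n) IHs => z Vz IHz [|i] y0 //=.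
  exact: IHz.
have /choice[c cP] s : exists z,
    E z /\ forall i y0, (i < size s)%N -> V (nth y0 s i) (size s) z.
  by have [z] := @filter_ex _ U _ _ (filterI UE (UVs s (size s))); exists z.
pose s := fix s n := if n is m.+1 then rcons (s m) (c (s m)) else [::].
have size_s n : size (s n) = n by elim: n => //= n IH; rewrite size_rcons IH.
exists (fun n => c (s n)) => [n|i n ltin]; first by case: (cP (s n)).
have [_ /(_ i (c [::]))] := cP (s n).
rewrite size_s => /(_ ltin).
suff -> : nth (c [::]) (s n) i = c (s i) by [].
elim: n ltin => // n IHn; rewrite ltnS leq_eqVlt /= nth_rcons size_s.
by case/predU1P => [->|/[dup] ltin ->]; [rewrite ltnn eqxx|exact: IHn].
Qed.

Lemma dist_lt_split (R : realType) (b a c e : R) :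
  `|a - b| < e / 2 -> `|b - c| < e / 2 -> `|a - c| < e.
Proof. by have := ler_distD b a c; lra. Qed.

(** A property of the functions [fun S => f (mix S y x)] on the cube [2^A], for
    which the assumption on the cardinality of [A] suffices. *)
Definition countably_recoverable (R : realType) (A : Type)
    (X : A -> topologicalType) (f : prod_topology X -> R) : Prop :=
  forall (x y : prod_topology X) (e : R), 0 < e ->
  exists2 S : A -> bool, countable [set a | S a] &
    `|f y - f (mix S y x)| < e.

(** Outside the union of the supports [S (z n)] the points
    [mix (S (z n)) (z n) x] have the coordinates of [x]. Each of the countably
    many coordinates inside it carries a countable basis [B a] taken from
    bi-sequentiality, and the sequence is made to enter the sets of [B a] one
    after the other. *)
Lemma support_diagonal (A : Type) (X : A -> topologicalType)
    (x : prod_topology X) (U : set_system (prod_topology X))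
    (E : set (prod_topology X)) (S : prod_topology X -> A -> bool) :
  (forall a, bi_sequential (X a)) -> UltraFilter U -> U --> x -> U E ->
  (forall y, countable [set a | S y a]) ->
  exists2 z : nat -> prod_topology X, forall n, E (z n) &
    (mix (S (z n)) (z n) x : prod_topology X) @[n --> \oo] --> x.
Proof.
move=> bX UU Ux UE cS.
pose h y : prod_topology X := mix (S y) y x.
have hx a : h y a @[y --> U] --> x a.
  move=> N xN; have /cvg_prod_topology/(_ a N xN) := Ux.
  apply: (@filterS _ U) => y /= yN; rewrite /h /mix.
  by case: ifP => // _; exact: nbhs_singleton.
have /choice[r rP] : forall y, exists r : A -> nat,
    {in [set a | S y a] &, injective r}.
  by move=> y; exact/countable_injP/cS.
have exB a : exists B : nat -> set (X a),
    (forall n, U [set y | B n (h y a)]) /\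
    (forall N, nbhs (x a) N -> exists n, B n `<=` N).
  have [B UB Bx] :=
    bi_sequential_basis (bX a) (ultra_fmap _ UU) (hx a).
  by exists B.
pose B a := sval (cid (exB a)).
have BP a := svalP (cid (exB a)).
(* A constraint set for each stage [n]: it involves the [a] of rank at most [n]
   in the support of [y], hence finitely many members of [U]. *)
pose V y n := [set z | forall a k, S y a -> (r y a <= n)%N -> (k <= n)%N ->
   B a k (h z a)].
have UV y n : U (V y n).
  have : \forall z \near U, forall (m k : 'I_n.+1) a, S y a -> r y a = m ->
      B a k (h z a).
    apply: filter_forall => m; apply: filter_forall => k.
    have [[a [Sa ra]]|nS] := pselect (exists a, S y a /\ r y a = m).
      have := (BP a).1 k; apply: (@filterS _ U) => z Bz b Sb rb.
      by rewrite (rP y b a) ?inE// rb ra.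
    by apply: nearW => z a Sa ra; case: nS; exists a.
  apply: (@filterS _ U) => z zP a k Sa ran kn.
  exact: (zP (Ordinal (ran : r y a < n.+1)%N) (Ordinal (kn : k < n.+1)%N)).
have [z Ez Vz] := diagonal_sequence _ UE UV.
exists z => //; apply/cvg_prod_topology => a N xN.
have [[i Sia]|nS] := pselect (exists i, S (z i) a); last first.
  exists 0%N => // n _ /=; rewrite /mix ifF; first exact: nbhs_singleton.
  by apply/negP => Sna; apply: nS; exists n.
have [k BN] := (BP a).2 _ xN.
exists (maxn i.+1 (maxn (r (z i) a) k)) => // n /=.
rewrite !geq_max => /and3P[ltin rn kn].
exact: BN _ (Vz i n ltin a k Sia rn kn).
Qed.

(** At a point of discontinuity, the sequence of [support_diagonal] converges to
    [x] while the values of [f] along it stay at distance at least [e / 2] from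
    [f x]. *)
Lemma recoverable_continuous (R : realType) (A : Type)
    (X : A -> topologicalType) (f : prod_topology X -> R) :
  (forall a, bi_sequential (X a)) ->
  sequentially_continuous f -> countably_recoverable f -> continuous f.
Proof.
move=> bX fseq fH x; apply/(@cvgrPdist_lt _ _ _ _ (nbhs_filter x)) => e e0.
apply: contrapT => nfx.
pose E := [set y | e <= `|f x - f y|].
have PE : ProperFilter (within E (nbhs x)).
  apply: Build_ProperFilter_ex => D DE; apply: contrapT => D0; apply: nfx.
  move: DE; apply: (@filterS _ (nbhs x) (nbhs_filter x)) => y Dy.
  rewrite ltNge; apply/negP => yE.
  by apply: D0; exists y; exact: Dy.
have [U [UU EU]] := ultraFilterLemma PE.
have UE : U E by apply: EU; exact: nearW.
have Ux : U --> x by move=> N xN; apply: EU; exact: cvg_within xN.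
have e20 : 0 < e / 2 by rewrite divr_gt0.
have /choice[S SP] : forall y, exists S : A -> bool, countable [set a | S a] /\
    `|f y - f (mix S y x)| < e / 2.
  by move=> y; have [S ? ?] := fH x y _ e20; exists S.
have [z Ez zx] := support_diagonal bX UU Ux UE (fun y => (SP y).1).
have /fseq/cvgrPdist_lt/(_ _ e20)/filter_ex[n /= zn] := zx.
have := Ez n; rewrite /E /= leNgt => /negP; apply.
apply: dist_lt_split zn _; rewrite distrC; exact: (SP (z n)).2.
Qed.

(** * Oscillation on the Cantor cube *)

(** The infimum of these [e] is monotone and subadditive in [T]: it plays the
    part of a measure of [T] attached to [g]. *)
Definition osc_le (R : realType) (A : Type) (g : (A -> bool) -> R) (e : R)
    (T : set A) : Prop :=
  forall P Q : A -> bool, (forall a, ~ T a -> P a = Q a) -> `|g P - g Q| <= e.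

(** If all the [T n] had oscillation greater than [e], there would be sets
    differing only inside [T n] on which the values of [g] are more than [e]
    apart. As each [a] lies in at most one [T n], the two sequences of sets have
    the same limit [p] along a nonprincipal ultrafilter on [nat], and [g]
    converges to [g p] along both. *)
Lemma disjoint_osc_le (R : realType) (A : Type)
    (g : prod_topology (fun _ : A => bool) -> R) (T : nat -> set A) (e : R) :
  omega_continuous g -> 0 < e -> trivIset setT T ->
  exists n, osc_le g e (T n).
Proof.
move=> gc e0 Tdisj; apply: contrapT => nosc.
have /choice[PQ PQP] : forall n, exists PQ : (A -> bool) * (A -> bool),
    (forall a, ~ T n a -> PQ.1 a = PQ.2 a) /\ ~ `|g PQ.1 - g PQ.2| <= e.
  move=> n; apply: contrapT => nPQ; apply: nosc; exists n => P Q PQ.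
  by apply: contrapT => gPQ; apply: nPQ; exists (P, Q).
have [U [UU Uoo]] := ultraFilterLemma eventually_filter.
pose p : prod_topology (fun _ : A => bool) :=
  fun a => `[< U [set n | (PQ n).1 a] >].
have Up a : U [set n | (PQ n).1 a = p a].
  rewrite /p; case: asboolP => // nU.
  have [//|] := in_ultra_setVsetC [set n | (PQ n).1 a] UU.
  by apply: (@filterS _ U) => n /= /negP/negbTE.
have Up2 a : U [set n | (PQ n).2 a = p a].
  have : U [set n | ~ T n a].
    have [[m Tma]|nT] := pselect (exists m, T m a).
      apply: Uoo; exists m.+1 => // n /= mn Tna.
      have mnE : m = n by apply: Tdisj => //; exists a.
      by rewrite mnE ltnn in mn.
    by apply: nearW => n Tna; apply: nT; exists n.
  by apply: (@filterS2 _ U _ _ _ _ _ (Up a)) => n /= <- /((PQP n).1 a).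
have lim (u : nat -> prod_topology (fun _ : A => bool)) :
    (forall a, U [set n | u n a = p a]) ->
    \forall n \near U, `|g p - g (u n)| < e / 2.
  move=> up; have e20 : 0 < e / 2 by rewrite divr_gt0.
  have /(cvg_omega_continuous gc _ (countable_range_countType u)) :
      u n @[n --> U] --> p.
    apply/cvg_prod_topology => a N /nbhs_singleton Npa.
    by apply: (@filterS _ U) (up a) => n /= ->.
  by move=> /cvgrPdist_lt/(_ _ e20).
have [n []] := filter_ex (filterI (lim _ Up) (lim _ Up2)).
rewrite distrC => gP gQ; apply: (PQP n).2.
by apply: ltW; apply: dist_lt_split gP gQ.
Qed.

(** The pieces may be countable besides having small oscillation, because a
    single point can carry a large oscillation. The sets with such a cover form
    a sigma-ideal. *)
Definition small_cover (R : realType) (A : Type) (g : (A -> bool) -> R) (e : R)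
    (T : set A) : Prop :=
  exists2 P : nat -> set A, forall n, countable (P n) \/ osc_le g e (P n) &
    T `<=` \bigcup_n P n.

Section SmallCover.
Context (R : realType) (A : Type) (g : (A -> bool) -> R) (e : R).
Implicit Types (T : set A).

Lemma small_cover_sub T T' :
  T `<=` T' -> small_cover g e T' -> small_cover g e T.
Proof. by move=> TT' [P sP T'P]; exists P => //; exact: subset_trans T'P. Qed.

Lemma small_cover_countable T : countable T -> small_cover g e T.
Proof. by move=> cT; exists (fun=> T) => [|a Ta]; [left|exists 0%N]. Qed.

Lemma small_cover_osc_le T : osc_le g e T -> small_cover g e T.
Proof. by move=> oT; exists (fun=> T) => [|a Ta]; [right|exists 0%N]. Qed.

Lemma small_cover_bigcup (I : Type) (D : set I) (T : I -> set A) :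
  countable D -> (forall i, D i -> small_cover g e (T i)) ->
  small_cover g e (\bigcup_(i in D) T i).
Proof.
move=> cD sT; have [[i Di]|D0] := pselect (D !=set0); last first.
  apply: (@small_cover_sub _ set0); last exact/small_cover_countable/countable0.
  by move=> a [i Di _]; apply: D0; exists i.
have [i_ iD] := countable_enum cD (ex_intro _ i Di).
have /choice[P PP] : forall n, exists P : nat -> set A,
    (forall k, countable (P k) \/ osc_le g e (P k)) /\
    T (i_ n) `<=` \bigcup_k P k.
  move=> n; have [|P ? ?] := sT (i_ n); last by exists P.
  by rewrite -iD; exists n.
(* Codes of no pair are sent to the empty, hence countable, set. *)
exists (fun m => if unpickle m is Some (n, k) then P n k else set0) => [m|a].
  by case: unpickle => [[n k]|]; [exact: (PP n).1|left; exact: countable0].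
rewrite -iD => -[_ [n _ <-] /(PP n).2[k _ Pka]].
by exists (pickle (n, k)); rewrite ?pickleK.
Qed.

Lemma small_cover_setU T T' :
  small_cover g e T -> small_cover g e T' -> small_cover g e (T `|` T').
Proof.
move=> sT sT'.
have := @small_cover_bigcup bool setT (fun b => if b then T else T')
  (countableP _).
move=> /(_ _)/small_cover_sub; apply; last by case.
by move=> a [Ta|Ta]; [exists true|exists false].
Qed.

End SmallCover.

(** * Covers by small pieces when [A] is not Ulam-measurable *)

(** If every uncovered set could be shrunk to an uncovered one by removing a
    set of oscillation greater than [e], iterating would produce a disjoint
    sequence of removed sets, which [disjoint_osc_le] excludes. *)
Lemma indecomposable_uncovered (R : realType) (A : Type)
    (g : prod_topology (fun _ : A => bool) -> R) (e : R) (T0 : set A) :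
  omega_continuous g -> 0 < e -> ~ small_cover g e T0 ->
  exists2 T, ~ small_cover g e T &
    forall D, D `<=` T -> ~ small_cover g e D -> osc_le g e (T `\` D).
Proof.
move=> gc e0 bT0; apply: contrapT => nT.
pose bad := {T : set A | ~ small_cover g e T}.
pose shrinks (T T' : bad) :=
  sval T' `<=` sval T /\ ~ osc_le g e (sval T `\` sval T').
have step T : {T' : bad | shrinks T T'}.
  apply: cid; apply: contrapT => nT'; apply: nT.
  case: T nT' => T bT nT'; exists T => // D DT bD; apply: contrapT => nD.
  by apply: nT'; exists (exist _ D bD).
have [T [_ Tshr]] := dependent_choice step (exist _ T0 bT0).
have Tdec n m : (n <= m)%N -> sval (T m) `<=` sval (T n).
  move=> /subnK <-; elim: (m - n)%N => // k IHk.
  exact: subset_trans (Tshr _).1 IHk.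
have [n] : exists n, osc_le g e (sval (T n) `\` sval (T n.+1)).
  apply: (@disjoint_osc_le _ _ _ (fun n => sval (T n) `\` sval (T n.+1)) _ gc)
    => //.
  have disj n m a : (n < m)%N -> (sval (T n) `\` sval (T n.+1)) a ->
      ~ (sval (T m) `\` sval (T m.+1)) a.
    by move=> nm [_ nTa] [Ta _]; apply: nTa; exact: Tdec nm _ Ta.
  move=> n m _ _ [a [na ma]].
  case: (ltngtP n m) => // nm; first by case: (disj _ _ _ nm na).
  by case: (disj _ _ _ nm ma).
exact: (Tshr n).2.
Qed.

(** On a set [T] as in [indecomposable_uncovered], the complement in [T] of an
    uncovered set has small oscillation and is therefore covered. So the covered
    sets form a prime sigma-ideal of subsets of [T], which contains the
    singletons: its dual filter is a free omega_1-complete ultrafilter. *)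
Lemma small_cover_setT (R : realType) (A : Type)
    (g : prod_topology (fun _ : A => bool) -> R) (e : R) :
  ~ Ulam_measurable_card A -> omega_continuous g -> 0 < e ->
  small_cover g e setT.
Proof.
move=> nUlam gc e0; apply: contrapT => bA; apply: nUlam.
have [T bT Tindec] := indecomposable_uncovered gc e0 bA.
pose V := [set D | ~ small_cover g e (D `&` T)].
have VS D D' : D `<=` D' -> V D -> V D'.
  by move=> DD' VD sD'; apply: VD; apply: small_cover_sub sD'; exact: setSI.
have Vsmall D : small_cover g e D -> V (~` D).
  move=> sD snD; apply: bT.
  apply: small_cover_sub (small_cover_setU sD snD) => a Ta.
  by have [Da|nDa] := pselect (D a); [left|right].
have VC D : V D -> small_cover g e (~` D `&` T).
  move=> VD; apply: small_cover_osc_le.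
  rewrite (_ : _ `&` _ = T `\` (D `&` T)); first by apply: Tindec => // a [].
  apply/seteqP; split=> [a [nDa Ta]|a [Ta nDT]]; split => //.
    by move=> [].
  by move=> Da; apply: nDT.
have Vcap : omega1_complete V.
  move=> C cC CV sC; apply: bT.
  have sU : small_cover g e (\bigcup_(S in C) (~` S `&` T)).
    by apply: small_cover_bigcup => // S /CV/VC.
  apply: small_cover_sub (small_cover_setU sC sU) => a Ta.
  have [Ca|nCa] := pselect ((\bigcap_(S in C) S) a); first by left.
  right; apply: contrapT => nU; apply: nCa => S CS.
  by apply: contrapT => nSa; apply: nU; exists S.
have VT : V setT by rewrite /V /= setTI.
have PV : ProperFilter V.
  split.
    rewrite /V /= set0I => -[].
    exact/small_cover_countable/countable0.
  split=> // D E VD VE.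
  (* Binary intersections are a case of countable ones. *)
  have : V (\bigcap_(S in [set D; E]) S).
    apply: Vcap; last by move=> S [->|->].
    by apply: countable_setU; exact: countable1.
  by apply: VS => a aDE; split; apply: aDE; [left|right].
exists V; split=> //.
  apply: ultra_of_setVsetC => D.
  have [/Vsmall VnD|VD] := pselect (small_cover g e (D `&` T)); last by left.
  right=> sD; apply: VnD.
  by apply: small_cover_sub sD => a [nDT Ta]; split=> // Da; exact: nDT.
apply/seteqP; split=> // a Va.
suff /Va : V (~` [set a]) by apply.
exact/Vsmall/small_cover_countable/countable1.
Qed.

(** * Approximation by finite modifications *)

(** The filter of sections of the directed family of finite subsets of [A],
    each given by a list of its elements. *)
Definition finite_subsets (A : Type) : set_system (seq {classic A}) :=
  filter_from setT (fun K0 : seq {classic A} =>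
    [set K : seq {classic A} | {subset K0 <= K}]).

Lemma finite_subsets_filter (A : Type) : ProperFilter (@finite_subsets A).
Proof.
apply: filter_from_proper; last by move=> K _; exists K => /=.
apply: filter_from_filter; first by exists [::].
move=> K L _ _; exists (K ++ L) => // M /= KLM.
by split=> a aK; apply: KLM; rewrite mem_cat aK ?orbT.
Qed.

Lemma cvg_finite_subsets (A : Type)
    (u : seq {classic A} -> prod_topology (fun _ : A => bool))
    (p : prod_topology (fun _ : A => bool)) :
  (forall K (a : {classic A}), a \in K -> u K a = p a) ->
  u K @[K --> @finite_subsets A] --> p.
Proof.
have FF := finite_subsets_filter A.
move=> up; apply/cvg_prod_topology => a N /nbhs_singleton Npa.
exists [:: a : {classic A}] => // K /= aK; rewrite up //.
by apply: aK; rewrite inE.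
Qed.

(** Each element of [K] lies in a piece, whose part off [C] is removed from [A].
    The successive pieces come from covers so fine that they change [g] by less
    than [d / 2], [d / 4], and so on. *)
Lemma near_small_pieces (R : realType) (A : Type) (g : (A -> bool) -> R)
    (C : set A) (P : nat -> nat -> set A) :
  (forall n, setT `<=` \bigcup_i P n i) ->
  (forall n i, P n i `<=` C \/ osc_le g n.+1%:R^-1 (P n i)) ->
  forall (K : seq {classic A}) (d : R), 0 < d ->
  exists2 L : seq (nat * nat),
    forall a, a \in K -> has (fun ni => `[< P ni.1 ni.2 a >]) L &
    `|g xpredT -
      g (fun a => `[< C a >] || ~~ has (fun ni => `[< P ni.1 ni.2 a >]) L)| < d.
Proof.
move=> Pcov Posc; elim=> [|a K IHK] d d0.
  exists [::] => //=.
  rewrite [X in g X - _](_ : _ = fun a => `[< C a >] || true) ?subrr ?normr0 //.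
  by apply/funext => a; rewrite orbT.
have d20 : 0 < d / 2 by rewrite divr_gt0.
have [L KL gL] := IHK _ d20.
have [n nd] : exists n, n.+1%:R^-1 < d / 2.
  have /filter_ex[n nd] := near_infty_natSinv_lt (PosNum d20).
  by exists n.
have [i _ Pa] := Pcov n a I.
exists ((n, i) :: L) => [b|].
  by rewrite inE => /predU1P[->|/KL /= ->]; rewrite ?orbT //=; case: asboolP.
apply: dist_lt_split gL _ => /=.
have [PC|Po] := Posc n i; last first.
  apply: le_lt_trans nd; apply: Po => b nPb.
  by rewrite (_ : `[< P n i b >] = false) //; apply: asboolF.
rewrite [X in _ - g X](_ : _ =
  fun b => `[< C b >] || ~~ has (fun ni => `[< P ni.1 ni.2 b >]) L).
  by rewrite subrr normr0.
apply/funext => b; case: (asboolP (C b)) => //= nCb.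
by rewrite (_ : `[< P n i b >] = false) //; apply: asboolF => /PC.
Qed.

(** The sets [W L] below are obtained from [A] by removing finitely many pieces
    off [C]. There are countably many of them; [C] is the limit of some of them
    on which [g] is within [d / 2] of [g A]; and [g] is omega-continuous. *)
Lemma countable_set_attains (R : realType) (A : Type)
    (g : prod_topology (fun _ : A => bool) -> R) :
  ~ Ulam_measurable_card A -> omega_continuous g ->
  exists2 S : A -> bool, countable [set a | S a] & g S = g xpredT.
Proof.
move=> nUlam gc.
have /choice[P PP] : forall n, exists P : nat -> set A,
    (forall i, countable (P i) \/ osc_le g n.+1%:R^-1 (P i)) /\
    setT `<=` \bigcup_i P i.
  move=> n; have [|P ? ?] := @small_cover_setT R A g n.+1%:R^-1 nUlam gc.
    by rewrite invr_gt0.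
  by exists P.
pose C := \bigcup_(ni in [set ni : nat * nat | countable (P ni.1 ni.2)])
  P ni.1 ni.2.
have cC : countable C by apply: bigcup_countable => //.
pose S : prod_topology (fun _ : A => bool) := fun a => `[< C a >].
exists S.
  by rewrite (_ : [set a | _] = C) //; apply/seteqP; split=> a /= /asboolP.
apply/eqP; rewrite -subr_eq0 -normr_le0; apply/ler_addgt0Pl => d d0.
rewrite addr0; have d20 : 0 < d / 2 by rewrite divr_gt0.
pose W (L : seq (nat * nat)) : prod_topology (fun _ : A => bool) :=
  fun a => `[< C a >] || ~~ has (fun ni => `[< P ni.1 ni.2 a >]) L.
have /choice[L LP] : forall K : seq {classic A}, exists L : seq (nat * nat),
    (forall a, a \in K -> has (fun ni => `[< P ni.1 ni.2 a >]) L) /\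
    `|g xpredT - g (W L)| < d / 2.
  move=> K.
  have [n|n i||L KL gL] := @near_small_pieces R A g C P _ _ K (d / 2).
  - exact: (PP n).2.
  - have [cP|oP] := (PP n).1 i; [left|by right].
    by move=> a Pa; exists (n, i).
  - by [].
  - by exists L.
have FF := finite_subsets_filter A.
have WS : W (L K) @[K --> @finite_subsets A] --> S.
  by apply: cvg_finite_subsets => K a aK; rewrite /W (LP K).1 ?orbF.
have cW : countable (range (fun K => W (L K))).
  apply: (@sub_countable _ _ _ (range W)).
    by apply: subset_card_le => _ [K _ <-]; exists (L K).
  exact: countable_range_countType.
have /cvgrPdist_lt/(_ _ d20)/filter_ex[K /= gK] :=
  cvg_omega_continuous gc FF cW WS.
by apply: ltW; apply: dist_lt_split gK _; rewrite distrC; exact: (LP K).2.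
Qed.

(** The whole of [A] is the limit in [2^A] of its finite subsets. *)
Lemma finite_sets_approximate (R : realType) (A : Type)
    (g : prod_topology (fun _ : A => bool) -> R) (e : R) :
  continuous g -> 0 < e ->
  exists2 S : A -> bool, countable [set a | S a] & `|g xpredT - g S| < e.
Proof.
move=> gc e0; have FF := finite_subsets_filter A.
pose u (K : seq {classic A}) : prod_topology (fun _ : A => bool) :=
  fun a => (a : {classic A}) \in K.
pose full : prod_topology (fun _ : A => bool) := xpredT.
have uT : u K @[K --> @finite_subsets A] --> full by exact: cvg_finite_subsets.
have : g (u K) @[K --> @finite_subsets A] --> g full.
  exact: cvg_comp uT (gc full).
move=> /cvgrPdist_lt/(_ _ e0)/filter_ex[K /= gK].
exists (u K) => //; apply: finite_set_countable.
exact: (@finite_seq {classic A}).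
Qed.

Theorem theorem4p4 (R : realType) (A : Type) (X : A -> topologicalType)
    (hX : forall a : A, bi_sequential (X a)) :
  (~ Ulam_measurable_card A ->
     countable_functional_tightness R (prod_topology X)) /\
  (~ sequential_card R A -> f_sequential R (prod_topology X)).
Proof.
split=> [nUlam f fc|/contrapT fA f fc].
  apply: recoverable_continuous => //.
    exact: omega_continuous_sequentially.
  move=> x y e e0.
  have [S cS gS] := countable_set_attains nUlam
    (omega_continuous_comp (@mix_continuous _ _ y x) fc).
  by exists S => //; move: gS => /= ->; rewrite subrr normr0.
apply: recoverable_continuous => // x y e e0.
have [S cS gS] := finite_sets_approximate (fA _
  (sequentially_continuous_comp (@mix_continuous _ _ y x) fc)) e0.
by exists S.
Qed.
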